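(* Let $\bar c\in\mathcal C$ be a null vertex of $\operatorname{conv}(\mathcal C)$, let $H'$ be an affine hyperplane of $\mathcal H$ strictly separating $\bar c$ from $\operatorname{conv}(\frac12(d+\mathcal W))$, let $P:\operatorname{conv}(\frac12(d+\mathcal W))\to H'$ send $\bar z$ to the intersection of the ray from $\bar c$ through $\bar z$ with $H'$, and let $\Delta=P(\operatorname{conv}(\frac12(d+\mathcal W)))$. Let $\bar\xi$ be a vertex of $\Delta$. Then exactly one of the following holds: (1A) $J(\bar c,\bar\xi)=0$ (and hence $P^{-1}(\bar\xi)$ is $J$-orthogonal to $\bar c$); (1B) the line through $\bar c,\bar\xi$ meets $\operatorname{conv}(\frac12(d+\mathcal W))$ in a unique point $\bar x$, and there is a null $\bar a\in\mathcal C$ with $\frac12(\bar a+\bar c)=\bar x$; (2) $J(\bar c,\bar\xi)\neq0$, and $\bar c,\bar\xi$ are collinear with an edge $\bar v\bar w$ of $\operatorname{conv}(\frac12(d+\mathcal W))$ (hence $c=2\bar c-d$ and $\xi=2\bar\xi-d$ are collinear with the corresponding edge $vw$ of $\operatorname{conv}(\mathcal W)$).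
   Context: Setting: $G$ compact Lie group, $K\subset G$ closed, $G/K$ connected almost effective, isotropy representation $\mathfrak p=\mathfrak p_1\oplus\cdots\oplus\mathfrak p_r$ ($r\ge2$) with pairwise inequivalent $\mathbb R$-irreducible summands, $d_i=\dim\mathfrak p_i$, $d=(d_1,\dots,d_r)$, $n=\sum d_i$. The scalar curvature of the metric $e^{q_i}Q$ on $\mathfrak p_i$ is $S(q)=\sum_{w\in\mathcal W}A_we^{w\cdot q}$, $\mathcal W\subset\mathbb Z^r$ finite, $A_w\ne0$, each $w$ of type I (one entry $-1$), type II (one entry $1$, two entries $-1$) or type III (one entry $1$, one entry $-2$), other entries $0$; $A_w>0$ for type I and $<0$ otherwise. Assume $\dim\operatorname{conv}(\mathcal W)=r-1$. $J$ is the symmetric bilinear form on $\mathbb R^r$ with $J(p,p)=\frac1{n-1}(\sum p_i)^2-\sum p_i^2/d_i$; $\bar x$ is null if $J(\bar x,\bar x)=0$. $u=\sum_{\bar c\in\mathcal C}F_{\bar c}e^{\bar c\cdot q}$ ($\mathcal C$ finite, $F_{\bar c}\ne0$) is a superpotential: for every $\xi$, $\sum_{(\bar a,\bar c)\in\mathcal C^2,\ \bar a+\bar c=\xi}J(\bar a,\bar c)F_{\bar a}F_{\bar c}$ equals $A_w$ if $\xi=d+w$, $w\in\mathcal W$, and $0$ otherwise. Normalise so that $\mathcal C$ lies in $\mathcal H=\{\sum\bar x_i=\frac12(n-1)\}$. For $x$ with $\sum x_i=-1$ write $\bar x=\frac12(d+x)\in\mathcal H$, and conversely $x=2\bar x-d$.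 A null vertex of $\operatorname{conv}(\mathcal C)$ lies outside $\operatorname{conv}(\frac12(d+\mathcal W))$. *)

(* Defs.v *)
From HB Require Import structures.
From mathcomp Require Import all_boot all_order all_algebra.
From mathcomp Require Import reals.
Set Implicit Arguments. Unset Strict Implicit. Unset Printing Implicit Defensive.
Import Order.TTheory GRing.Theory Num.Theory.
Local Open Scope ring_scope.

Section Defs.
Variable R : realType.
Variable r : nat.
Local Notation vec := 'rV[R]_r.

Definition dotv (p q : vec) : R := \sum_(i < r) p 0 i * q 0 i.

Definition ndim (d : 'I_r -> nat) : nat := (\sum_(i < r) d i)%N.

Definition dvec (d : 'I_r -> nat) : vec := \row_(i < r) ((d i)%:R : R).

(* J(p,q) = (sum p)(sum q)/(n-1) - sum p_i q_i / d_i  (polarisation of the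
   quadratic form in the paper) *)
Definition Jform (d : 'I_r -> nat) (p q : vec) : R :=
  (\sum_(i < r) p 0 i) * (\sum_(i < r) q 0 i) / ((ndim d)%:R - 1)
  - \sum_(i < r) p 0 i * q 0 i / (d i)%:R.

Definition is_null (d : 'I_r -> nat) (x : vec) : Prop := Jform d x x = 0.

Definition inH (d : 'I_r -> nat) (x : vec) : Prop :=
  \sum_(i < r) x 0 i = ((ndim d)%:R - 1) / 2.

Definition barv (d : 'I_r -> nat) (x : vec) : vec := 2^-1 *: (dvec d + x).

Definition conv (s : seq vec) (x : vec) : Prop :=
  exists lam : 'I_(size s) -> R,
    (forall i, 0 <= lam i) /\ \sum_(i < size s) lam i = 1 /\
    x = \sum_(i < size s) lam i *: s`_i.

Definition is_vertex (S : vec -> Prop) (x : vec) : Prop :=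
  S x /\ forall (y z : vec) (t : R), S y -> S z -> 0 < t -> t < 1 ->
    x = t *: y + (1 - t) *: z -> y = x /\ z = x.

Definition segment (v w x : vec) : Prop :=
  exists t : R, 0 <= t /\ t <= 1 /\ x = (1 - t) *: v + t *: w.

Definition on_line (p q x : vec) : Prop := exists s : R, x = p + s *: (q - p).

Definition is_edge (S : vec -> Prop) (v w : vec) : Prop :=
  v <> w /\ exists (f : vec) (g : R),
    (forall x, S x -> dotv f x <= g) /\
    (forall x, (S x /\ dotv f x = g) <-> segment v w x).

Definition exactly_one3 (P1 P2 P3 : Prop) : Prop :=
  (P1 /\ ~ P2 /\ ~ P3) \/ (~ P1 /\ P2 /\ ~ P3) \/ (~ P1 /\ ~ P2 /\ P3).

End Defs.
Arguments dvec {R r} d.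

Definition typeI (r : nat) (w : 'rV[int]_r) : Prop :=
  exists i : 'I_r, w 0 i = -1 /\ forall j, j != i -> w 0 j = 0.
Definition typeII (r : nat) (w : 'rV[int]_r) : Prop :=
  exists i j k : 'I_r, [/\ i != j, i != k & j != k] /\
    w 0 i = 1 /\ w 0 j = -1 /\ w 0 k = -1 /\
    forall l, l != i -> l != j -> l != k -> w 0 l = 0.
Definition typeIII (r : nat) (w : 'rV[int]_r) : Prop :=
  exists i j : 'I_r, i != j /\ w 0 i = 1 /\ w 0 j = -2 /\
    forall l, l != i -> l != j -> w 0 l = 0.

Definition realv (R : realType) (r : nat) (w : 'rV[int]_r) : 'rV[R]_r :=
  map_mx (fun z : int => z%:~R) w.

Definition affdim (R : realType) (r : nat) (s : seq 'rV[R]_r) : nat :=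
  \rank (\matrix_(i < size s, j < r) (s`_i 0 j - s`_0 0 j)).

(* Main.v *)
Require Import Defs.
From HB Require Import structures.
From mathcomp Require Import all_boot all_order all_algebra.
From mathcomp Require Import reals ring lra.
Import Order.TTheory GRing.Theory Num.Theory.
Local Open Scope ring_scope.

(* Put the origin at cb. The cone spanned by C lies in the cone spanned by
   (d+W)/2: a face of the former beyond the latter would carry a solution of the
   homogeneous superpotential equation, forced to lie in the orthogonal of cb,
   where J is definite. A vertex xib of Delta spans an extremal ray of the cone of
   (d+W)/2, cut out by a supporting functional (Gordan's alternative). Suppose
   J(cb, xib) <> 0. If several points of (d+W)/2 lie on the ray, this is case (2).
   If there is only one, the elements of C in the supporting hyperplane are on the
   ray as well, and the superpotential equation restricted to them is a problem in
   one variable, whose solution is (1B). *)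

(** * The Euclidean pairing *)

Section Dot.
Context {R : realType} {r : nat}.
Implicit Types p q f x y z : 'rV[R]_r.

Lemma dotvC p q : dotv p q = dotv q p.
Proof. by apply: eq_bigr => i _; rewrite mulrC. Qed.

Lemma dotvDr f p q : dotv f (p + q) = dotv f p + dotv f q.
Proof. by rewrite -big_split; apply: eq_bigr => i _; rewrite mxE mulrDr. Qed.

Lemma dotvZr f k p : dotv f (k *: p) = k * dotv f p.
Proof. by rewrite mulr_sumr; apply: eq_bigr => i _; rewrite mxE; ring. Qed.

Lemma dotv0r f : dotv f 0 = 0.
Proof. by rewrite -(scale0r 0) dotvZr mul0r. Qed.

Lemma dotvNr f p : dotv f (- p) = - dotv f p.
Proof. by rewrite -scaleN1r dotvZr mulN1r. Qed.

Lemma dotvBr f p q : dotv f (p - q) = dotv f p - dotv f q.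
Proof. by rewrite dotvDr dotvNr. Qed.

Lemma dotvDl p q f : dotv (p + q) f = dotv p f + dotv q f.
Proof. by rewrite !(dotvC _ f) dotvDr. Qed.

Lemma dotvZl k p f : dotv (k *: p) f = k * dotv p f.
Proof. by rewrite !(dotvC _ f) dotvZr. Qed.

Lemma dotvBl p q f : dotv (p - q) f = dotv p f - dotv q f.
Proof. by rewrite !(dotvC _ f) dotvBr. Qed.

Lemma dotvNl p f : dotv (- p) f = - dotv p f.
Proof. by rewrite !(dotvC _ f) dotvNr. Qed.

Lemma dotv_sumr f (I : Type) (s : seq I) (U : I -> 'rV[R]_r) :
  dotv f (\sum_(i <- s) U i) = \sum_(i <- s) dotv f (U i).
Proof. exact: (big_morph (dotv f) (dotvDr f) (dotv0r f)). Qed.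

Lemma dotv_ge0 p : 0 <= dotv p p.
Proof. by apply: sumr_ge0 => i _; rewrite -expr2 sqr_ge0. Qed.

Lemma dotv_eq0 p : (dotv p p == 0) = (p == 0).
Proof.
apply/idP/eqP => [|->]; last by rewrite dotv0r.
rewrite psumr_eq0 => [/allP pp0|i _]; last by rewrite -expr2 sqr_ge0.
apply/rowP => i; rewrite mxE; apply/eqP.
by have := pp0 i (mem_index_enum i); rewrite /= mulf_eq0 orbb.
Qed.

Lemma dotv_gt0 p : (0 < dotv p p) = (p != 0).
Proof. by rewrite lt_def dotv_ge0 andbT dotv_eq0. Qed.

(** Adding the two bounds cancels the cross terms and leaves [dotv q q <= 0]. *)
Lemma dotv_parallelogram p q : dotv (p + q) (p + q) <= dotv p p ->
  dotv (p - q) (p - q) <= dotv p p -> q = 0.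
Proof.
rewrite !(dotvDr, dotvDl, dotvNr, dotvC (- _)) (dotvC q p) => le1 le2.
by apply/eqP; rewrite -dotv_eq0 eq_le dotv_ge0 andbT; lra.
Qed.

Lemma dotv_unitl p : dotv (const_mx 1) p = \sum_(i < r) p 0 i.
Proof. by apply: eq_bigr => i _; rewrite mxE mul1r. Qed.

End Dot.

(** * Extrema and strict inequalities over finite lists *)

Section Finite.
Context {R : realType}.

Lemma seq_argmax {T : eqType} (s : seq T) (h : T -> R) x0 :
  x0 \in s -> exists2 x, x \in s & forall y, y \in s -> h y <= h x.
Proof.
elim: s x0 => // a s IH x0 _; case: s IH => [|b s] IH.
  by exists a => [|y]; rewrite ?inE // => /eqP ->.
have [x xs hx] := IH b (mem_head _ _).
have [le_xa|lt_ax] := lerP (h x) (h a).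
  exists a; first exact: mem_head.
  by move=> y /predU1P[-> //|/hx /le_trans]; apply.
exists x; first by rewrite inE xs orbT.
by move=> y; rewrite in_cons => /predU1P[->|/hx //]; exact: ltW.
Qed.

(** Serves to tilt a functional that is negative on finitely many vectors. *)
Lemma small_perturbation {T : eqType} (s : seq T) (a b : T -> R) :
  (forall i, i \in s -> a i < 0) ->
  exists2 e : R, 0 < e & forall i, i \in s -> a i + e * b i < 0.
Proof.
elim: s => [|i s IH] a_lt0; first by exists 1.
have [j js|e e0 He] := IH; first by apply: a_lt0; rewrite inE js orbT.
have ai := a_lt0 i (mem_head _ _).
have shrink (x y e1 e2 : R) : x < 0 -> x + e1 * y < 0 -> 0 < e2 -> e2 <= e1 ->
    x + e2 * y < 0.
  by move=> x0 xy e20 le; have [y0|y0] := lerP y 0; nra.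
have n0 : 0 < `|b i| + 1 by rewrite ltr_wpDl.
have k0 : 0 < - a i / (`|b i| + 1) by rewrite divr_gt0 // oppr_gt0.
(* The added 1 keeps the denominator positive and the resulting inequality strict. *)
exists (Num.min e (- a i / (`|b i| + 1))); first by rewrite lt_min e0.
have m0 : 0 < Num.min e (- a i / (`|b i| + 1)) by rewrite lt_min e0.
move=> j; rewrite in_cons => /predU1P[->|js].
  apply: (shrink _ _ (- a i / (`|b i| + 1))) => //; last by rewrite ge_min lexx orbT.
  rewrite -subr_gt0 in ai.
  have -> : a i + - a i / (`|b i| + 1) * b i
            = a i * ((`|b i| - b i) + 1) / (`|b i| + 1) by field; rewrite gt_eqF.
  rewrite pmulr_llt0 ?invr_gt0 // nmulr_rlt0; last by lra.
  by rewrite ltr_wpDl // subr_ge0 ler_norm.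
have aj : a j < 0 by apply: a_lt0; rewrite in_cons js orbT.
by apply: shrink aj (He j js) m0 _; rewrite ge_min lexx.
Qed.

End Finite.

(** * Gordan's alternative and exposed vertices *)

Section Gordan.
Context {R : realType} {r : nat}.
Implicit Types (f x y z : 'rV[R]_r).

(** Fourier-Motzkin elimination: a functional negative on the tail is kept if it is negative at the
    new vector and tilted if it vanishes there; otherwise the tail is moved into its kernel along
    the new vector. *)
Lemma gordan {I : eqType} (s : seq I) (U : I -> 'rV[R]_r) : uniq s ->
  (exists f, forall i, i \in s -> dotv f (U i) < 0) \/
  (exists m : I -> R, [/\ forall i, 0 <= m i, exists2 i, i \in s & 0 < m i
     & \sum_(i <- s) m i *: U i = 0]).
Proof.
elim: s U => [|k s IH] U /=; first by left; exists 0.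
move=> /andP[kNs us].
have neqk i : i \in s -> (i == k) = false.
  by move=> si; apply: contraNF kNs => /eqP <-.
have [[f fs]|[m [m0 [i si mi] ms]]] := IH U us; last first.
  right; exists (fun j => if j == k then 0 else m j); split=> [j||].
  - by case: eqP.
  - by exists i; rewrite ?inE ?si ?orbT // neqk.
  rewrite big_cons eqxx scale0r add0r -[RHS]ms.
  by apply: eq_big_seq => j sj; rewrite neqk.
have [fk|fk|fk] := ltrgt0P (dotv f (U k)); last first.
- have [Uk0|Uk0] := eqVneq (U k) 0.
    right; exists (fun j => (j == k)%:R); split=> [j||].
    + by rewrite ler0n.
    + by exists k; rewrite ?mem_head // eqxx ltr01.
    rewrite big_cons Uk0 scaler0 add0r big1_seq // => j /andP[_ sj].
    by rewrite neqk // scale0r.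
  have [e e0 He] := small_perturbation s (fun i => dotv f (U i))
                      (fun i => dotv (- U k) (U i)) fs.
  left; exists (f + e *: (- U k)) => i; rewrite in_cons => /predU1P[->|si].
    rewrite dotvDl fk add0r dotvZl dotvC dotvNr pmulr_rlt0 // oppr_lt0.
    by rewrite dotv_gt0.
  by rewrite dotvDl dotvZl; exact: He.
- by left; exists f => i; rewrite in_cons => /predU1P[->|/fs].
(* [V i] is a positive combination of [U i] and [U k] in the kernel of [f], so a relation among the
   [V i] gives one among the [U i] and [U k]. *)
pose V i := dotv f (U k) *: U i - dotv f (U i) *: U k.
have [[g gs]|[m [m0 [i si mi] ms]]] := IH V us.
  have [e e0 He] := small_perturbation s (fun i => dotv g (V i))
                      (fun i => - dotv f (U i)) gs.
  (* Without its term in [e] this functional is 0 at [U k] and [dotv g (V i)] at [U i]; that term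
     makes it negative at [U k]. *)
  left; exists (dotv f (U k) *: g - dotv g (U k) *: f - e *: f).
  move=> i; rewrite in_cons => /predU1P[->|si]; rewrite !dotvBl !dotvZl.
    rewrite (_ : _ - _ = - (e * dotv f (U k))); last by ring.
    by rewrite oppr_lt0 mulr_gt0.
  have := He i si; rewrite dotvBr !dotvZr.
  by congr (_ < _); ring.
right; exists (fun j => if j == k then \sum_(i <- s) m i * - dotv f (U i)
                        else m j * dotv f (U k)); split=> [j||].
- case: eqP => _; last by rewrite mulr_ge0 // ltW.
  rewrite big_seq sumr_ge0 // => h /fs fh; rewrite mulr_ge0 //; lra.
- by exists i; rewrite ?inE ?si ?orbT // neqk // mulr_gt0.
rewrite big_cons eqxx scaler_suml -big_split -[RHS]ms.
apply: eq_big_seq => j sj; rewrite /= neqk // /V scalerBr !scalerA addrC.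
by rewrite mulrN scaleNr.
Qed.

(** Otherwise Gordan's alternative gives a nonnegative relation among the [p - x]. Normalised, it
    writes [x] as a convex combination of points other than [x], and splitting one of them off
    contradicts extremality. *)
Lemma exposed_vertex (s : seq 'rV[R]_r) x :
  (forall y z t, conv s y -> conv s z -> 0 < t -> t < 1 ->
     x = t *: y + (1 - t) *: z -> y = x /\ z = x) ->
  exists f, forall p, p \in s -> p != x -> dotv f (p - x) < 0.
Proof.
move=> extr; pose I := 'I_(size s); pose P (i : I) := s`_i != x.
have [[f fP]|[m [m0 [i]]]] :=
    gordan (filter P (index_enum I)) (fun i => s`_i - x)
      (filter_uniq _ (index_enum_uniq _)).
  exists f => p ps px; have ip : (index p s < size s)%N by rewrite index_mem.
  have := fP (Ordinal ip); rewrite mem_filter /P /= nth_index // px.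
  by apply; rewrite mem_index_enum.
rewrite mem_filter => /andP[Pi _] mi; rewrite big_filter => ms.
pose M := \sum_(j | P j) m j.
have M0 : 0 < M by rewrite /M (bigD1 i) //= ltr_wpDr // sumr_ge0.
pose lam j := if P j then m j / M else 0.
have lam0 j : 0 <= lam j by rewrite /lam; case: ifP => // _; rewrite divr_ge0 // ltW.
have lam1 : \sum_j lam j = 1.
  by rewrite -big_mkcond -mulr_suml divff // gt_eqF.
have lamx : x = \sum_j lam j *: s`_j.
  have : \sum_j lam j *: (s`_j - x) = 0.
    rewrite -[RHS](scaler0 _ M^-1) -[in RHS]ms scaler_sumr [RHS]big_mkcond.
    apply: eq_bigr => j _; rewrite /lam; case: ifP => _; last by rewrite scale0r.
    by rewrite scalerA mulrC.
  under eq_bigr do rewrite scalerBr.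
  by rewrite sumrB -scaler_suml lam1 scale1r => /subr0_eq.
have lami : 0 < lam i by rewrite /lam Pi divr_gt0.
have lami1 : lam i <= 1.
  by rewrite -lam1 (bigD1 i) //= lerDl sumr_ge0.
(* Half the weight, so that [1 - t] is positive even if [lam i] is 1. *)
pose t := lam i / 2.
have t0 : 0 < t by rewrite /t; lra.
have t1 : t < 1 by rewrite /t; lra.
pose mu j := (1 - t)^-1 * (lam j - t *+ (j == i)).
have [|||||] := extr s`_i (\sum_j mu j *: s`_j) t => //.
- exists (fun j => (j == i)%:R); split => [j|]; first by rewrite ler0n.
  split; first by rewrite (bigD1 i) //= eqxx big1 ?addr0 // => j /negbTE ->.
  rewrite (bigD1 i) //= eqxx scale1r big1 ?addr0 // => j /negbTE ->.
  by rewrite scale0r.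
- exists mu; split=> [j|].
    rewrite mulr_ge0 ?invr_ge0 ?subr_ge0 ?(ltW t1) //.
    by case: eqP => [->|_]; rewrite ?mulr0n ?mulr1n // /t; lra.
  split=> //; rewrite -mulr_sumr sumrB lam1 (bigD1 i) //= eqxx big1 => [|j /negbTE -> //].
  by rewrite addr0 mulVf // subr_eq0 gt_eqF.
- rewrite scaler_sumr {1}lamx.
  rewrite (bigD1 i) // [in RHS](bigD1 i) //= addrA; congr (_ + _).
    rewrite scalerA -scalerDl /mu eqxx mulVKf ?subr_eq0 ?gt_eqF //.
    by congr (_ *: _); rewrite mulr1n; ring.
  apply: eq_bigr => j /negbTE ji.
  by rewrite scalerA /mu ji subr0 mulVKf // subr_eq0 gt_eqF.
by move=> xi _; rewrite /P xi eqxx in Pi.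
Qed.

End Gordan.

(** * The bilinear form J *)

Section Jform.
Context {R : realType} {r : nat}.
Variable d : 'I_r -> nat.
Implicit Types p q x y z : 'rV[R]_r.

Lemma JformC p q : Jform d p q = Jform d q p.
Proof.
rewrite /Jform; congr (_ - _); first by rewrite [X in X / _]mulrC.
by apply: eq_bigr => i _; rewrite [X in X / _]mulrC.
Qed.

Lemma JformDr p x y : Jform d p (x + y) = Jform d p x + Jform d p y.
Proof.
rewrite /Jform -!dotv_unitl dotvDr.
have -> : \sum_(i < r) p 0 i * (x + y) 0 i / (d i)%:R
  = \sum_(i < r) p 0 i * x 0 i / (d i)%:R + \sum_(i < r) p 0 i * y 0 i / (d i)%:R.
  by rewrite -big_split; apply: eq_bigr => i _ /=; rewrite mxE; ring.
by ring.
Qed.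

Lemma JformZr p k x : Jform d p (k *: x) = k * Jform d p x.
Proof.
rewrite /Jform -!dotv_unitl dotvZr.
have -> : \sum_(i < r) p 0 i * (k *: x) 0 i / (d i)%:R
  = k * (\sum_(i < r) p 0 i * x 0 i / (d i)%:R).
  by rewrite mulr_sumr; apply: eq_bigr => i _ /=; rewrite mxE; ring.
by ring.
Qed.

Lemma JformDl p x y : Jform d (x + y) p = Jform d x p + Jform d y p.
Proof. by rewrite !(JformC _ p) JformDr. Qed.

Lemma JformZl p k x : Jform d (k *: x) p = k * Jform d x p.
Proof. by rewrite !(JformC _ p) JformZr. Qed.

Lemma JformBr p x y : Jform d p (x - y) = Jform d p x - Jform d p y.
Proof. by rewrite -scaleN1r JformDr JformZr mulN1r. Qed.

Lemma JformBl p x y : Jform d (x - y) p = Jform d x p - Jform d y p.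
Proof. by rewrite !(JformC _ p) JformBr. Qed.

Lemma Jform_line x v s t : Jform d (x + s *: v) (x + t *: v) =
  Jform d x x + (s + t) * Jform d x v + s * t * Jform d v v.
Proof.
by rewrite !(JformDl, JformDr, JformZl, JformZr) (JformC v x); ring.
Qed.

(* On vectors with zero entry sum, J is minus a weighted sum of squares. *)
Lemma Jform_definite x : (forall i, (0 < d i)%N) ->
  \sum_(i < r) x 0 i = 0 -> Jform d x x = 0 -> x = 0.
Proof.
move=> d0 x0; rewrite /Jform x0 !mul0r sub0r => /eqP; rewrite oppr_eq0.
have di i : 0 < (d i)%:R :> R by rewrite ltr0n.
rewrite psumr_eq0 => [/allP Jx|i _]; last first.
  by rewrite divr_ge0 ?(ltW (di i)) // -expr2 sqr_ge0.
apply/rowP => i; rewrite mxE; apply/eqP; have := Jx i (mem_index_enum i).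
by rewrite /= mulf_eq0 mulf_eq0 invr_eq0 (gt_eqF (di i)) orbF orbb.
Qed.

(** The difference is null with zero entry sum, and J is definite on such vectors. *)
Lemma orthogonal_null_eq x y : (forall i, (0 < d i)%N) -> inH d x -> inH d y ->
  Jform d x x = 0 -> Jform d y y = 0 -> Jform d x y = 0 -> y = x.
Proof.
move=> d0 Hx Hy Jx Jy Jxy; apply/eqP; rewrite -subr_eq0; apply/eqP.
apply: Jform_definite => //.
  by rewrite -dotv_unitl dotvBr !dotv_unitl Hx Hy subrr.
by rewrite !(JformBl, JformBr) (JformC y x) Jx Jy Jxy !subrr.
Qed.

End Jform.

(** * Consequences of the superpotential equation *)

Section Superpotential.
Context {R : realType} {r : nat}.
Variables (d : 'I_r -> nat) (W : seq 'rV[int]_r) (A : 'rV[int]_r -> R).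
Variables (C : seq 'rV[R]_r) (F : 'rV[R]_r -> R).
Hypothesis d_gt0 : forall i, (0 < d i)%N.
Hypothesis C_uniq : uniq C.
Hypothesis F_neq0 : forall c, c \in C -> F c != 0.
Hypothesis C_inH : forall c, c \in C -> inH d c.
Hypothesis superpotential : forall xi : 'rV[R]_r,
  \sum_(a <- C) \sum_(c <- C | a + c == xi) Jform d a c * F a * F c
  = \sum_(w <- W | dvec d + realv R w == xi) A w.

(** At [a + b] the left side of the equation has only the terms of (a, b) and (b, a), which are
    equal and so cannot cancel; hence the right side is not an empty sum. *)
Lemma unique_sum a b : a \in C -> b \in C ->
    (forall x y, x \in C -> y \in C -> x + y = a + b ->
       (x = a /\ y = b) \/ (x = b /\ y = a)) ->
  Jform d a b != 0 -> exists2 w, w \in W & dvec d + realv R w = a + b.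
Proof.
move=> aC bC uniq_ab Jab.
case: (boolP (has (fun w => dvec d + realv R w == a + b) W)) => [|noW].
  by case/hasP => w wW /eqP; exists w.
have inner x y : y \in C -> x + y = a + b ->
    \sum_(c <- C | x + c == a + b) Jform d x c * F x * F c
    = Jform d x y * F x * F y.
  move=> yC <-; under eq_bigl do rewrite (inj_eq (addrI x)).
  by rewrite -big_filter filter_pred1_uniq // big_seq1.
have := superpotential (a + b); rewrite (big_hasC _ _ _ noW).
have other x : x \in C -> x != a -> x != b ->
    \sum_(c <- C | x + c == a + b) Jform d x c * F x * F c = 0.
  move=> xC xa xb; rewrite big1_seq // => y /andP[/eqP xy yC].
  by case: (uniq_ab x y xC yC xy) => -[xE _]; rewrite xE eqxx in xa xb.
have T0 : Jform d a b * F a * F b != 0 by rewrite !mulf_neq0 // F_neq0.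
rewrite (bigD1_seq a) //= (inner a b) //.
have [ab|neq_ab] := eqVneq b a.
  rewrite big1_seq => [|x /andP[xa xC]]; last by rewrite other // ab.
  by rewrite addr0 => /eqP; rewrite (negbTE T0).
rewrite -big_filter (bigD1_seq b) ?filter_uniq ?mem_filter ?neq_ab //=.
rewrite (inner b a) // 1?addrC // big1_seq => [|x]; last first.
  by rewrite mem_filter => /andP[xb /andP[xa xC]]; rewrite other.
rewrite addr0 (JformC d b a) => /eqP.
have -> : Jform d a b * F b * F a + Jform d a b * F a * F b
  = 2 * (Jform d a b * F a * F b) by ring.
by rewrite mulf_eq0 (negbTE T0) pnatr_eq0.
Qed.

Variable cb : 'rV[R]_r.
Hypothesis cb_in : cb \in C.
Hypothesis cb_null : Jform d cb cb = 0.
Hypothesis cb_vertex : is_vertex (conv C) cb.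

(* The cone at cb spanned by C lies in the cone spanned by the points (d+w)/2.
   Otherwise consider the face of the former that is furthest from the latter:
   no sum of two of its points is of the form d+w, so the restriction of the
   superpotential to it solves the homogeneous equation. A shortest point
   not orthogonal to cb contradicts this, so the whole face is orthogonal to cb;
   then the longest one is null, hence equal to cb. *)
Lemma cone_le f :
  (forall w, w \in W -> dotv f (barv d (realv R w) - cb) <= 0) ->
  forall a, a \in C -> dotv f (a - cb) <= 0.
Proof.
move=> fW a0 a0C; rewrite leNgt; apply/negP => fa0.
(* [- dotv g (a - cb)] serves as the length of [a] seen from [cb]. *)
have [g gC] := exposed_vertex C cb (proj2 cb_vertex).
have a0cb : a0 != cb by apply: contraTneq fa0 => ->; rewrite subrr dotv0r ltxx.
pose C1 := [seq a <- C | a != cb].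
have C1P a : (a \in C1) = (a != cb) && (a \in C) by rewrite mem_filter.
have a0C1 : a0 \in C1 by rewrite C1P a0cb.
have [b bC1 bmax] := seq_argmax C1 (fun a => dotv f (a - cb) / - dotv g (a - cb)) a0 a0C1.
have gC1 a : a \in C1 -> 0 < - dotv g (a - cb).
  by rewrite C1P oppr_gt0 => /andP[acb aC]; exact: gC.
(* The largest slope of [f] against that length: [f + M *: g] is nonpositive on C, and its zeros
   other than [cb] form the face [E]. *)
pose M := dotv f (b - cb) / - dotv g (b - cb).
have M0 : 0 < M.
  by apply: lt_le_trans (bmax _ a0C1); rewrite divr_gt0 // gC1.
pose phi := f + M *: g.
have phiE a : dotv phi (a - cb) = dotv f (a - cb) + M * dotv g (a - cb).
  by rewrite dotvDl dotvZl.
have phi_le a : a \in C -> dotv phi (a - cb) <= 0.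
  move=> aC; have [->|acb] := eqVneq a cb; first by rewrite subrr dotv0r.
  have aC1 : a \in C1 by rewrite C1P acb.
  have := bmax a aC1; rewrite -/M ler_pdivrMr ?gC1 // phiE; lra.
pose E := [seq a <- C1 | dotv phi (a - cb) == 0].
have EP a : (a \in E) = [&& dotv phi (a - cb) == 0, a != cb & a \in C].
  by rewrite mem_filter C1P.
have bE : b \in E.
  rewrite mem_filter bC1 andbT phiE /M.
  by apply/eqP; field; rewrite lt_eqF // -oppr_gt0 gC1.
have f_gt0 a : a \in E -> 0 < dotv f (a - cb).
  rewrite mem_filter phiE => /andP[/eqP fa /gC1 ga].
  have : 0 < M * - dotv g (a - cb) by rewrite mulr_gt0.
  lra.
(* Half of such a sum would be a point of (d+W)/2 at which [f] exceeds its value at [cb]. *)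
have notW x y : x \in E -> y \in E \/ y = cb ->
    ~ exists2 w, w \in W & dvec d + realv R w = x + y.
  move=> /f_gt0 fx fy [w /fW]; rewrite /barv => + dw.
  rewrite dw dotvBr dotvZr dotvDr.
  have : 0 <= dotv f (y - cb).
    by case: fy => [/f_gt0/ltW//|->]; rewrite subrr dotv0r.
  move: fx; rewrite !dotvBr; lra.
have closed x y a c : a \in E -> c \in E \/ c = cb ->
    x \in C -> y \in C -> x + y = a + c ->
    dotv phi (x - cb) = 0 /\ dotv phi (y - cb) = 0.
  rewrite EP => /and3P[/eqP pa _ _] cE xC yC xy.
  have pc : dotv phi (c - cb) = 0.
    by case: cE => [|->]; rewrite ?subrr ?dotv0r // EP => /and3P[/eqP].
  have := phi_le x xC; have := phi_le y yC.
  have : dotv phi (x + y) = dotv phi (a + c) by rewrite xy.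
  move: pa pc; rewrite !dotvBr !dotvDr; lra.
have mem_E x : x \in C -> dotv phi (x - cb) = 0 -> x != cb -> x \in E.
  by move=> xC px xcb; rewrite EP px eqxx xcb.
have orth a : a \in E -> Jform d cb a = 0.
  pose E1 := [seq a <- E | Jform d cb a != 0] => aE; apply/eqP/negPn/negP => Ja.
  have aE1 : a \in E1 by rewrite mem_filter Ja.
  (* As [g] is negative, its maximum marks the shortest point. If x + y = e + cb with x and y both
     different from [cb], both are shorter than [e], hence orthogonal to [cb], against J(cb, e) <>
     0. *)
  have [e] := seq_argmax E1 (fun a => dotv g (a - cb)) a aE1.
  rewrite mem_filter => /andP[Je eE] emax.
  have eC : e \in C by move: eE; rewrite EP => /and3P[].
  apply: (notW e cb) => //; first by right.
  apply: (unique_sum e cb) => //; last by rewrite JformC.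
  move=> x y xC yC xy.
  have [px py] := closed x y e cb eE (or_intror erefl) xC yC xy.
  have [xcb|xcb] := eqVneq x cb.
    by right; split => //; apply: (addrI x); rewrite xy xcb addrC.
  have [ycb|ycb] := eqVneq y cb.
    by left; split => //; apply: (addIr y); rewrite xy ycb.
  have xE := mem_E x xC px xcb; have yE := mem_E y yC py ycb.
  have gx : dotv g (x - cb) < 0 by apply: gC.
  have gy : dotv g (y - cb) < 0 by apply: gC.
  have gxy : dotv g (x + y) = dotv g (e + cb) by rewrite xy.
  have Jxy : Jform d cb (x + y) = Jform d cb (e + cb) by rewrite xy.
  have Jx : Jform d cb x = 0.
    apply/eqP/negPn/negP => Jx; have := emax x.
    rewrite mem_filter Jx xE => /(_ isT).
    by move: gx gy gxy; rewrite !dotvBr !dotvDr; lra.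
  have Jy : Jform d cb y = 0.
    apply/eqP/negPn/negP => Jy; have := emax y.
    rewrite mem_filter Jy yE => /(_ isT).
    by move: gx gy gxy; rewrite !dotvBr !dotvDr; lra.
  move: Jxy; rewrite !JformDr Jx Jy cb_null !addr0 => Je0.
  by rewrite -Je0 eqxx in Je.
(* Length is now Euclidean: if x + y = 2e and neither is farther from [cb] than [e], then x = y =
   e. *)
have [e eE emax] := seq_argmax E (fun a => dotv (a - cb) (a - cb)) b bE.
have /and3P[_ ecb eC] : [&& dotv phi (e - cb) == 0, e != cb & e \in C].
  by rewrite -EP.
have [Je|Je] := eqVneq (Jform d e e) 0.
  case/eqP: ecb; apply: (orthogonal_null_eq d cb e) => //; try exact: C_inH.
  exact: orth.
apply: (notW e e) => //; first by left.
apply: (unique_sum e e) => // x y xC yC xy.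
have [px py] := closed x y e e eE (or_introl eE) xC yC xy.
have norm_le z : z \in C -> dotv phi (z - cb) = 0 ->
    dotv (z - cb) (z - cb) <= dotv (e - cb) (e - cb).
  move=> zC pz; have [->|zcb] := eqVneq z cb; last by apply/emax/mem_E.
  by rewrite subrr dotv0r dotv_ge0.
have := norm_le x xC px; have := norm_le y yC py.
have yE : y = e + e - x by rewrite -xy addrAC subrr add0r.
rewrite yE; set u := e - cb; set v := x - e.
have -> : x - cb = u + v by apply/rowP => i; rewrite !mxE; ring.
have -> : e + e - x - cb = u - v by apply/rowP => i; rewrite !mxE; ring.
move=> le1 le2; have v0 : v = 0 by apply: dotv_parallelogram le2 le1.
have xe : x = e by apply: subr0_eq.
by left; rewrite xe addrK.
Qed.

Hypothesis W_uniq : uniq W.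
Hypothesis A_neq0 : forall w, w \in W -> A w != 0.

(** [realv] is injective, so the right side at d + w is the nonzero A_w and the left side cannot be
    empty. *)
Lemma sum_of_weight w : w \in W ->
  exists x y, [/\ x \in C, y \in C & x + y = dvec d + realv R w].
Proof.
move=> wW; have := superpotential (dvec d + realv R w).
have realv_inj : injective (@realv R r).
  move=> u v /matrixP uv; apply/rowP => i; have := uv 0 i.
  by rewrite !mxE => /eqP; rewrite eqr_int => /eqP.
under [RHS]eq_bigl do rewrite (inj_eq (addrI _)) (inj_eq realv_inj).
rewrite -[RHS]big_filter filter_pred1_uniq // big_seq1 => sumA.
have [/hasP[x xC /hasP[y yC /eqP xy]]|none] :=
  boolP (has (fun x => has (fun y => x + y == dvec d + realv R w) C) C).
  by exists x, y.
have := A_neq0 w wW; rewrite -sumA big1_seq ?eqxx // => x /andP[_ xC].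
by rewrite big_hasC //; have /hasPn/(_ x xC) := none.
Qed.

(* With only one point of (d+W)/2 on an extremal ray from cb, the exponents on
   that ray are found from its ends: the first one, a, is such that cb + a is in
   d + W, the last one is null, and so is orthogonal to the one before it,
   which a null direction excludes unless that is cb. *)
Lemma isolated_ray f l w0 (xb := barv d (realv R w0)) : w0 \in W ->
  (forall w, w \in W -> dotv l (barv d (realv R w) - cb) < 0) ->
  (forall w, w \in W -> barv d (realv R w) = xb \/
                        dotv f (barv d (realv R w) - cb) < 0) ->
  dotv f (xb - cb) = 0 -> Jform d cb xb != 0 ->
  exists2 a, a \in C & is_null d a /\ 2^-1 *: (a + cb) = xb.
Proof.
move=> w0W lW fW fxb Jxb; pose rho := xb - cb.
have l_rho : dotv l rho < 0 by apply: lW.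
have rho_neq0 : rho != 0 by apply: contraTneq l_rho => ->; rewrite dotv0r ltxx.
have rho2 : 0 < dotv rho rho by rewrite dotv_gt0.
have Jrho : Jform d cb rho = Jform d cb xb by rewrite JformBr cb_null subr0.
have f_le a : a \in C -> dotv f (a - cb) <= 0.
  by apply: cone_le => w wW; case: (fW w wW) => [->|/ltW//]; rewrite fxb.
(* The coordinate along the ray, 0 at [cb] and 1 at [xb]. *)
pose h a := dotv rho (a - cb) / dotv rho rho.
have h_cb : h cb = 0 by rewrite /h subrr dotv0r mul0r.
(* Let [phi] be the part of [a - cb] orthogonal to [rho]. A slight tilt of [f] towards [phi] stays
   nonpositive on (d+W)/2, hence on C by [cone_le], yet its value at [a - cb] is a positive multiple
   of |phi|^2. *)
have onray a : a \in C -> dotv f (a - cb) = 0 -> a = cb + h a *: rho.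
  move=> aC fa; pose phi := (a - cb) - h a *: rho.
  have phi_rho : dotv phi rho = 0.
    by rewrite dotvBl dotvZl (dotvC _ rho) /h; field; rewrite gt_eqF.
  have [w|e e0 He] := small_perturbation
      [seq w <- W | barv d (realv R w) != xb]
      (fun w => dotv f (barv d (realv R w) - cb))
      (fun w => dotv phi (barv d (realv R w) - cb)).
    by rewrite mem_filter => /andP[wxb /fW[] // wE]; rewrite wE eqxx in wxb.
  have : dotv (f + e *: phi) (a - cb) <= 0.
    apply: cone_le aC => w wW; rewrite dotvDl dotvZl.
    have [->|wxb] := eqVneq (barv d (realv R w)) xb.
      by rewrite fxb phi_rho mulr0 addr0.
    by apply/ltW/He; rewrite mem_filter wxb.
  rewrite dotvDl dotvZl fa add0r pmulr_rle0 //.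
  have -> : dotv phi (a - cb) = dotv phi phi.
    have -> : a - cb = phi + h a *: rho by rewrite subrK.
    by rewrite (dotvDr phi) dotvZr phi_rho mulr0 addr0.
  move=> phi_le; have : phi = 0 by apply/eqP; rewrite -dotv_eq0 eq_le phi_le dotv_ge0.
  by move=> /subr0_eq <-; rewrite addrC subrK.
pose E a := (a \in C) && (dotv f (a - cb) == 0).
have EP a : E a -> a \in C /\ a = cb + h a *: rho.
  by move=> /andP[aC /eqP fa]; split=> //; exact: onray.
have E_cb : E cb by rewrite /E cb_in subrr dotv0r eqxx.
have E_inj x y : E x -> E y -> h x = h y -> x = y.
  by move=> /EP[_ xE] /EP[_ yE] hE; rewrite xE hE -yE.
have h_gt0 a : E a -> a != cb -> 0 < h a.
  move=> Ea acb; have [aC aE] := EP a Ea.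
  have la : dotv l (a - cb) <= 0 by apply: cone_le aC => w /lW/ltW.
  rewrite lt_def; apply/andP; split.
    by apply: contra_neq acb => h0; rewrite aE h0 scale0r addr0.
  by move: la; rewrite {1}aE addrC addKr dotvZr nmulr_lle0.
have h_ge0 a : E a -> 0 <= h a.
  by move=> Ea; have [->|/(h_gt0 a Ea)/ltW//] := eqVneq a cb; rewrite h_cb.
have hD x y a b : x + y = a + b -> h x + h y = h a + h b.
  move=> xy; rewrite /h -!mulrDl -!dotvDr; congr (dotv rho _ / _).
  by rewrite addrACA xy addrACA.
have E_sum x y a b : E a -> E b -> x \in C -> y \in C -> x + y = a + b ->
    E x /\ E y.
  move=> /andP[_ /eqP fa] /andP[_ /eqP fb] xC yC xy; rewrite /E xC yC /=.
  have := f_le x xC; have := f_le y yC.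
  have : dotv f (x + y) = dotv f (a + b) by rewrite xy.
  move: fa fb; rewrite !dotvBr !dotvDr => fa fb fxy fx fy.
  by split; apply/eqP; lra.
(* [xb] is the only point of (d+W)/2 in the supporting hyperplane. *)
have sumW a b : E a -> E b -> (exists2 w, w \in W & dvec d + realv R w = a + b) ->
    2^-1 *: (a + b) = xb /\ h a + h b = 2.
  move=> /andP[aC /eqP fa] /andP[bC /eqP fb] [w wW dw].
  have wxb : 2^-1 *: (a + b) = xb.
    have [<-|] := fW w wW; first by rewrite /barv dw.
    rewrite /barv dw dotvBr dotvZr dotvDr.
    by move: fa fb; rewrite !dotvBr => *; exfalso; lra.
  split=> //; rewrite /h -mulrDl -dotvDr (_ : a - cb + (b - cb) = 2 *: rho).
    by rewrite dotvZr mulfK // gt_eqF.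
  by rewrite /rho -wxb; apply/rowP => i; rewrite !mxE; field.
have JE a b : E a -> E b -> Jform d a b
    = (h a + h b) * Jform d cb xb + h a * h b * Jform d rho rho.
  move=> /EP[_ aE] /EP[_ bE]; rewrite [in LHS]aE [in LHS]bE Jform_line.
  by rewrite cb_null add0r Jrho.
pose C1 := [seq a <- C | E a && (a != cb)].
have C1P a : (a \in C1) = E a && (a != cb).
  by rewrite mem_filter; apply: andb_idr => /andP[/andP[]].
have C1_C a : a \in C1 -> a \in C by rewrite mem_filter => /andP[].
(* A pair with sum d + w0 = 2 xb lies in the hyperplane, and its members are not both [cb]. *)
have [x [y [xC yC xy]]] := sum_of_weight w0 w0W.
have [b bC1] : exists b, b \in C1.
  have xyE : x + y = xb + xb.
    by rewrite xy -[RHS]addr0 /xb /barv; apply/rowP => i; rewrite !mxE; field.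
  have fxy : dotv f (x + y) = dotv f (xb + xb) by rewrite xyE.
  have [Ex Ey] : E x /\ E y.
    have := f_le x xC; have := f_le y yC; rewrite /E xC yC /=.
    move: fxy fxb; rewrite !dotvBr !dotvDr => *.
    by split; apply/eqP; lra.
  have [xcb|xcb] := eqVneq x cb; last by exists x; rewrite C1P Ex.
  exists y; rewrite C1P Ey; apply: contraNneq rho_neq0 => ycb.
  move: xyE; rewrite xcb ycb => /rowP cbxb; apply/eqP/rowP => i.
  by have := cbxb i; rewrite !mxE; lra.
have [a aC1 amin] := seq_argmax C1 (fun a => - h a) b bC1.
have /andP[Ea acb] : E a && (a != cb) by rewrite -C1P.
have h_min z : z \in C1 -> h a <= h z by move/amin; rewrite lerN2.
have [e eC1 emax] := seq_argmax C1 h b bC1.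
have /andP[Ee ecb] : E e && (e != cb) by rewrite -C1P.
have h_max z : E z -> h z <= h e.
  move=> Ez; have [->|zcb] := eqVneq z cb; first by rewrite h_cb h_ge0.
  by apply: emax; rewrite C1P Ez.
(* Any other pair with the sum a + cb avoids [cb], so by minimality its coordinates add up to at
   least 2 h(a) > h(a). *)
have [xb_a ha2] : 2^-1 *: (a + cb) = xb /\ h a + h cb = 2.
  apply: sumW => //; apply: unique_sum => //; first exact: C1_C; last first.
    rewrite JE // h_cb addr0 mulr0 mul0r addr0 mulf_neq0 // gt_eqF //.
    exact: h_gt0.
  move=> u v uC vC uv; have [Eu Ev] := E_sum u v a cb Ea E_cb uC vC uv.
  have [ucb|ucb] := eqVneq u cb.
    by right; split => //; apply: (addrI u); rewrite uv ucb addrC.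
  have [vcb|vcb] := eqVneq v cb.
    by left; split => //; apply: (addIr v); rewrite uv vcb.
  have := h_min u; have := h_min v; rewrite !C1P Eu Ev ucb vcb.
  move=> /(_ isT) hv /(_ isT) hu; have := hD _ _ _ _ uv.
  by have := h_gt0 u Eu ucb; rewrite h_cb => *; exfalso; lra.
rewrite h_cb addr0 in ha2.
(* Otherwise h(e) = 1, below the minimum h(a) = 2. *)
have Je : Jform d e e = 0.
  apply/eqP/negPn/negP => Je; have [] : 2^-1 *: (e + e) = xb /\ h e + h e = 2.
    apply: sumW => //; apply: unique_sum => //; try exact: C1_C.
    move=> u v uC vC uv; have [Eu Ev] := E_sum u v e e Ee Ee uC vC uv.
    have := h_max u Eu; have := h_max v Ev; have := hD _ _ _ _ uv => huv hu hv.
    by left; split; apply: E_inj => //; lra.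
  by move=> _; have := h_min e eC1; lra.
have [ea|neq_ea] := eqVneq e a; first exists a.
- exact: C1_C.
- by split=> //; rewrite /is_null -ea.
pose C2 := [seq z <- C1 | z != e].
have aC2 : a \in C2 by rewrite mem_filter aC1 eq_sym neq_ea.
(* [k] comes just before [e]: a pair avoiding [e] has coordinate sum at most 2 h(k) < h(e) + h(k),
   so e + k is attained only by [e] and [k]. *)
have [k kC2 kmax] := seq_argmax C2 h a aC2.
have [ke kC1] : k != e /\ k \in C1 by move: kC2; rewrite mem_filter => /andP[].
have /andP[Ek kcb] : E k && (k != cb) by rewrite -C1P.
have hke : h k < h e.
  by rewrite lt_def h_max // andbT; apply: contra_neq ke => /esym; exact: E_inj.
have k_max z : E z -> z != e -> h z <= h k.
  move=> Ez ze; have [->|zcb] := eqVneq z cb; first by rewrite h_cb h_ge0.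
  by apply: kmax; rewrite mem_filter ze C1P Ez.
have [_] : 2^-1 *: (e + k) = xb /\ h e + h k = 2.
  apply: sumW => //; apply: unique_sum => //; try exact: C1_C.
    move=> u v uC vC uv; have [Eu Ev] := E_sum u v e k Ee Ek uC vC uv.
    have [ue|ue] := eqVneq u e.
      by left; split => //; apply: (addrI u); rewrite uv ue.
    have [ve|ve] := eqVneq v e.
      by right; split => //; apply: (addIr v); rewrite uv ve addrC.
    have := k_max u Eu ue; have := k_max v Ev ve; have := hD _ _ _ _ uv => *.
    by exfalso; lra.
  have he : h e != 0 by rewrite gt_eqF // h_gt0.
  (* Subtracting h(k) times J(e, e) = 0 eliminates J(rho, rho). *)
  have : h e * Jform d e k = h e * (h e - h k) * Jform d cb xb.
    have Je' := Je; rewrite JE // in Je'; rewrite JE //.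
    rewrite -[RHS]addr0 -[in RHS](mulr0 (h k)) -[in RHS]Je'; ring.
  apply: contra_eq_neq => ->; rewrite mulr0 eq_sym.
  apply: mulf_neq0 => //; apply: mulf_neq0 => //.
  by rewrite subr_eq0 gt_eqF.
by have := h_min k kC1 => *; exfalso; lra.
Qed.

End Superpotential.

(** * Convex hulls of finite lists *)

Section Hull.
Context {R : realType} {r : nat}.
Implicit Types (f g p q x y z : 'rV[R]_r) (s : seq 'rV[R]_r).

Lemma conv_mem s p : p \in s -> conv s p.
Proof.
move=> ps; have ip : (index p s < size s)%N by rewrite index_mem.
pose i := Ordinal ip; exists (fun j => (j == i)%:R).
split=> [j|]; first by rewrite ler0n.
split; rewrite (bigD1 i) //= eqxx.
  by rewrite big1 ?addr0 // => j /negbTE ->.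
rewrite scale1r nth_index // big1 ?addr0 // => j /negbTE ->.
by rewrite scale0r.
Qed.

Lemma conv_segment s x y t : conv s x -> conv s y -> 0 <= t -> t <= 1 ->
  conv s ((1 - t) *: x + t *: y).
Proof.
move=> [a [a0 [a1 ->]]] [b [b0 [b1 ->]]] t0 t1.
exists (fun i => (1 - t) * a i + t * b i); split=> [i|].
  by rewrite addr_ge0 // mulr_ge0 // subr_ge0.
split; first by rewrite big_split -!mulr_sumr a1 b1 /=; ring.
rewrite !scaler_sumr -big_split; apply: eq_bigr => i _ /=.
by rewrite !scalerA scalerDl.
Qed.

Lemma conv_mapP s (h : 'rV[R]_r -> 'rV[R]_r) y :
  conv [seq h p | p <- s] y <->
  exists lam : 'I_(size s) -> R, (forall i, 0 <= lam i) /\ \sum_i lam i = 1 /\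
    y = \sum_i lam i *: h s`_i.
Proof.
have sz := size_map h s.
have reidx (V : nmodType) (G : 'I_(size [seq h p | p <- s]) -> V) :
    \sum_i G i = \sum_(i < size s) G (cast_ord (esym sz) i).
  by apply: reindex; exists (cast_ord sz) => i _; rewrite ?cast_ordK ?cast_ordKV.
split=> -[lam [lam0 [lam1 ->]]].
  exists (fun i => lam (cast_ord (esym sz) i)); split=> //.
  split; first by rewrite -reidx.
  rewrite reidx; apply: eq_bigr => i _.
  by congr (_ *: _); exact: (nth_map 0 0 h (ltn_ord i)).
exists (fun i => lam (cast_ord sz i)); split=> //.
split; rewrite reidx; first by under eq_bigr do rewrite cast_ordKV.
apply: eq_bigr => i _; rewrite cast_ordKV.
by congr (_ *: _); exact/esym/(nth_map 0 0 h (ltn_ord i)).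
Qed.

(** The gaps [k - dotv f p], weighted by the coefficients of [x], are nonnegative with sum zero; so
    only generators on the supporting hyperplane carry weight. *)
Lemma conv_face_le s x f k g m : conv s x ->
  (forall p, p \in s -> dotv f p <= k) -> dotv f x = k ->
  (forall p, p \in s -> dotv f p = k -> dotv g p <= m) -> dotv g x <= m.
Proof.
move=> [lam [lam0 [lam1 xE]]] fk fx gm.
have slack i : 0 <= lam i * (k - dotv f s`_i).
  by rewrite mulr_ge0 // subr_ge0 fk ?mem_nth.
have : \sum_i lam i * (k - dotv f s`_i) == 0.
  under eq_bigr do rewrite mulrBr -dotvZr.
  by rewrite sumrB -mulr_suml lam1 mul1r -dotv_sumr -xE fx subrr.
rewrite psumr_eq0 => [/allP tight|i _]; last exact: slack.
rewrite -[m]mul1r -lam1 mulr_suml xE dotv_sumr; apply: ler_sum => i _.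
rewrite dotvZr; have := tight i (mem_index_enum i).
rewrite /= mulf_eq0 => /orP[/eqP ->|]; first by rewrite !mul0r.
by rewrite subr_eq0 => /eqP fi; rewrite ler_wpM2l // gm ?mem_nth.
Qed.

Lemma conv_le s x f k : conv s x ->
  (forall p, p \in s -> dotv f p <= k) -> dotv f x <= k.
Proof.
move=> sx fk; apply: (conv_face_le s x 0 0 f k sx) => [p _||p ps _]; last exact: fk.
  by rewrite dotvC dotv0r.
by rewrite dotvC dotv0r.
Qed.

Lemma conv_eq s x f k : conv s x ->
  (forall p, p \in s -> dotv f p = k) -> dotv f x = k.
Proof.
move=> sx fk; apply/eqP; rewrite eq_le; apply/andP; split.
  by apply: conv_le sx _ => p /fk ->.
rewrite -lerN2 -dotvNl; apply: conv_le sx _ => p /fk fp.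
by rewrite dotvNl fp.
Qed.

Lemma conv_nonempty s x : conv s x -> exists p, p \in s.
Proof.
case: s => [[lam [_ [/eqP]]]|p s _]; last by exists p; exact: mem_head.
by rewrite big_ord0 eq_sym oner_eq0.
Qed.

End Hull.

(** * Lines, central projection and extremal rays *)

Section Lines.
Context {R : realType} {r : nat}.
Implicit Types (f g l p q x y z c : 'rV[R]_r) (s : seq 'rV[R]_r).

Lemma on_line_dotv f c x p : dotv f (x - c) = 0 -> on_line c x p ->
  dotv f p = dotv f c.
Proof. by move=> fx [s ->]; rewrite dotvDr dotvZr fx mulr0 addr0. Qed.

Lemma on_line_inj l c x p q : dotv l (x - c) != 0 ->
  on_line c x p -> on_line c x q -> dotv l p = dotv l q -> p = q.
Proof.
move=> lx [a ->] [b ->]; rewrite !dotvDr !dotvZr => /addrI /(mulIf lx) ab.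
by rewrite ab.
Qed.

Lemma on_line_change c x v w y : v <> w ->
  on_line c x v -> on_line c x w -> on_line c x y -> on_line v w y.
Proof.
move=> vw [a vE] [b wE] [e ->].
have ab : b - a != 0.
  by rewrite subr_eq0; apply/eqP => ba; apply: vw; rewrite vE wE ba.
exists ((e - a) / (b - a)); rewrite vE wE; apply/rowP => i; rewrite !mxE.
by field.
Qed.

Lemma on_line_homothety (k : R) z p q x : on_line p q x ->
  on_line (k *: p - z) (k *: q - z) (k *: x - z).
Proof. by move=> [s ->]; exists s; apply/rowP => i; rewrite !mxE; ring. Qed.

(** The part of [z - c] orthogonal to the line pairs to zero with the line's direction, so
    [conv_face_le] bounds its squared norm by 0. *)
Lemma on_line_conv s c x f z : conv s z ->
  (forall p, p \in s -> on_line c x p \/ dotv f (p - c) < 0) ->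
  dotv f (x - c) = 0 -> x != c -> dotv f z = dotv f c -> on_line c x z.
Proof.
move=> sz fs fx xc fz; have x2 : dotv (x - c) (x - c) != 0.
  by rewrite dotv_eq0 subr_eq0.
pose k := dotv (x - c) (z - c) / dotv (x - c) (x - c).
pose phi := (z - c) - k *: (x - c).
have phix : dotv phi (x - c) = 0.
  by rewrite dotvBl dotvZl (dotvC (z - c)) /k divfK // subrr.
have : dotv phi z <= dotv phi c.
  apply: (conv_face_le s z f (dotv f c)) => // p ps.
    case: (fs p ps) => [/(on_line_dotv f _ _ _ fx) -> //|].
    by rewrite dotvBr subr_lt0 => /ltW.
  move=> fp; case: (fs p ps) => [/(on_line_dotv phi _ _ _ phix) -> //|].
  by rewrite dotvBr fp subrr ltxx.
rewrite -subr_le0 -dotvBr; have -> : z - c = phi + k *: (x - c) by rewrite subrK.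
rewrite (dotvDr phi) dotvZr phix mulr0 addr0 => phi_le.
have phi0 : phi = 0 by apply/eqP; rewrite -dotv_eq0 eq_le phi_le dotv_ge0.
by exists k; move/subr0_eq: phi0 => <-; rewrite addrC subrK.
Qed.

(** The projection from [c] to the hyperplane through [x] on which [l] is constant. *)
Definition central_proj l c x p : 'rV[R]_r :=
  c + (dotv l (x - c) / dotv l (p - c)) *: (p - c).

(** The projection is not affine: each weight is multiplied by the scale factor [tau] of its
    generator, and the total [N] becomes the ray parameter. *)
Lemma central_proj_conv s l c x y :
  (forall p, p \in s -> dotv l (p - c) < 0) -> dotv l (x - c) < 0 ->
  conv [seq central_proj l c x p | p <- s] y ->
  exists2 z, conv s z & exists2 t, 0 <= t & y = c + t *: (z - c).
Proof.
move=> ls lx /conv_mapP[lam [lam0 [lam1 yE]]].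
pose tau i := dotv l (x - c) / dotv l (s`_i - c).
have tau0 (i : 'I_(size s)) : 0 < tau i.
  by rewrite /tau -mulrNN -invrN divr_gt0 // oppr_gt0 // ls ?mem_nth.
pose N := \sum_(i < size s) lam i * tau i.
have N0 : 0 < N.
  rewrite lt_def sumr_ge0 ?andbT => [|i _]; last by rewrite mulr_ge0 // ltW.
  rewrite psumr_eq0 => [|i _]; last by rewrite mulr_ge0 // ltW.
  apply: contra_eqN lam1 => /allP lam00; rewrite big1 ?(eq_sym 0) ?oner_eq0 //.
  move=> i _; have := lam00 i (mem_index_enum i).
  by rewrite /= mulf_eq0 (gt_eqF (tau0 i)) orbF => /eqP.
exists (\sum_(i < size s) (lam i * tau i / N) *: s`_i).
  exists (fun i => lam i * tau i / N); split=> [i|].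
    by apply: divr_ge0; [apply: mulr_ge0 => //|]; exact: ltW.
  by split=> //; rewrite -mulr_suml divff // gt_eqF.
exists N; first exact: ltW.
rewrite scalerBr scaler_sumr /N scaler_suml -sumrB.
rewrite yE -[X in _ = X + _]scale1r -lam1 scaler_suml -big_split.
apply: eq_bigr => i _; rewrite /= /central_proj -/(tau i) -/N scalerDr !scalerA.
by rewrite [N * _]mulrC divfK ?gt_eqF // scalerBr.
Qed.

(** A functional exposing [x] among the projected generators is corrected by a multiple of [l] to
    vanish on [x - c]. As [l] is constant on the projections, the signs persist, and positive
    scaling carries them back to the generators. *)
Lemma exposed_ray s l c x :
  (forall p, p \in s -> dotv l (p - c) < 0) -> dotv l (x - c) < 0 ->
  (forall y z t, conv [seq central_proj l c x p | p <- s] y ->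
     conv [seq central_proj l c x p | p <- s] z -> 0 < t -> t < 1 ->
     x = t *: y + (1 - t) *: z -> y = x /\ z = x) ->
  exists2 f, dotv f (x - c) = 0 &
    forall p, p \in s -> on_line c x p \/ dotv f (p - c) < 0.
Proof.
move=> ls lx extr; have [f0 f0P] := exposed_vertex _ _ extr.
pose f := f0 - (dotv f0 (x - c) / dotv l (x - c)) *: l.
have fx : dotv f (x - c) = 0.
  by rewrite dotvBl dotvZl divfK ?lt_eqF // subrr.
exists f => // p ps; have lp := ls p ps.
pose tau := dotv l (x - c) / dotv l (p - c).
have tau0 : 0 < tau by rewrite /tau -mulrNN -invrN divr_gt0 // oppr_gt0.
have [px|px] := eqVneq (central_proj l c x p) x.
  have xE : x - c = tau *: (p - c) by rewrite -[in LHS]px addrAC subrr add0r.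
  left; exists tau^-1; rewrite xE.
  by rewrite scalerA mulVf ?gt_eqF // scale1r addrC subrK.
right; rewrite -(pmulr_rlt0 _ tau0) -dotvZr.
have -> : tau *: (p - c) = (central_proj l c x p - x) + (x - c).
  by rewrite addrA subrK addrAC subrr add0r.
rewrite dotvDr fx addr0 dotvBl dotvZl.
have -> : dotv l (central_proj l c x p - x) = 0.
  rewrite !(dotvBr, dotvDr, dotvZr) -!dotvBr divfK ?lt_eqF // !dotvBr; ring.
by rewrite mulr0 subr0; apply: f0P => //; exact: map_f.
Qed.

End Lines.

(** * The weights, and the passage between W and (d+W)/2 *)

Lemma sum_weight (r : nat) (w : 'rV[int]_r) :
  typeI w \/ typeII w \/ typeIII w -> \sum_(i < r) w 0 i = -1.
Proof.
case=> [[i [wi w0]]|[[i [j [k [[ij ik jk] [wi [wj [wk w0]]]]]]]|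
        [i [j [ij [wi [wj w0]]]]]]].
- by rewrite (bigD1 i) //= big1 ?wi ?addr0.
- rewrite (bigD1 i) // (bigD1 j) 1?eq_sym // (bigD1 k) /=; last first.
    by rewrite !(eq_sym k) ik.
  rewrite big1 ?wi ?wj ?wk // => l /andP[/andP[li lj] lk]; exact: w0.
rewrite (bigD1 i) // (bigD1 j) 1?eq_sym //= big1 ?wi ?wj //.
by move=> l /andP[li lj]; exact: w0.
Qed.

Lemma barv_inH (R : realType) (r : nat) (d : 'I_r -> nat) (w : 'rV[int]_r) :
  \sum_(i < r) w 0 i = -1 -> inH d (barv d (realv R w)).
Proof.
move=> w1; rewrite /inH -dotv_unitl dotvZr dotvDr !dotv_unitl.
have -> : \sum_(i < r) realv R w 0 i = -1.
  under eq_bigr do rewrite mxE.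
  by rewrite -(raddf_sum (intr : {additive int -> R})) w1.
have -> : \sum_(i < r) (dvec d : 'rV[R]_r) 0 i = (ndim d)%:R.
  by under eq_bigr do rewrite mxE; rewrite /ndim natr_sum.
by rewrite mulrC.
Qed.

Lemma conv_barv (R : realType) (r : nat) (d : 'I_r -> nat) (s : seq 'rV[int]_r)
    (x : 'rV[R]_r) :
  conv [seq realv R w | w <- s] x <->
  conv [seq barv d (realv R w) | w <- s] (barv d x).
Proof.
have -> : [seq barv d (realv R w) | w <- s]
        = [seq barv d p | p <- [seq realv R w | w <- s]] by rewrite -map_comp.
rewrite conv_mapP; set t := [seq realv R w | w <- s].
have barv_sum (lam : 'I_(size t) -> R) : \sum_i lam i = 1 ->
    \sum_i lam i *: barv d t`_i = barv d (\sum_i lam i *: t`_i).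
  move=> lam1; rewrite /barv -[X in X + _]scale1r -lam1 scaler_suml -big_split.
  by rewrite scaler_sumr; apply: eq_bigr => i _; rewrite /= -scalerDr !scalerA mulrC.
split=> -[lam [lam0 [lam1 xE]]]; exists lam; split=> //; split=> //.
  by rewrite barv_sum // xE.
move: xE; rewrite barv_sum // /barv => /(scalerI (_ : 2^-1 != 0 :> R)).
by move=> /(_ (invr_neq0 _))/addrI; apply; rewrite pnatr_eq0.
Qed.

Lemma barvK (R : realType) (r : nat) (d : 'I_r -> nat) (x : 'rV[R]_r) :
  2 *: barv d x - dvec d = x.
Proof. by apply/rowP => i; rewrite !mxE; field. Qed.

(** [barv d] is an affine bijection with positive ratio, so the same normal vector supports the
    edge, at a rescaled level. *)
Lemma is_edge_barv (R : realType) (r : nat) (d : 'I_r -> nat)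
    (s : seq 'rV[int]_r) (v w : 'rV[R]_r) :
  is_edge (conv [seq barv d (realv R u) | u <- s]) v w ->
  is_edge (conv [seq realv R u | u <- s]) (2 *: v - dvec d) (2 *: w - dvec d).
Proof.
have two : (2 : R) != 0 by rewrite pnatr_eq0.
move=> [vw [f [g [fg face]]]]; split.
  by move/addIr/(scalerI two).
have fE x : dotv f x = 2 * dotv f (barv d x) - dotv f (dvec d).
  by rewrite -dotvZr -dotvBr barvK.
exists f, (2 * g - dotv f (dvec d)); split=> [x|x].
  by move/(conv_barv R r d)/fg; rewrite (fE x); lra.
have -> : (conv [seq realv R u | u <- s] x /\ dotv f x = 2 * g - dotv f (dvec d))
    <-> segment v w (barv d x).
  rewrite -face -conv_barv (fE x); split=> -[sx fx]; split=> //; last by rewrite fx.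
  by apply: (mulfI two); lra.
split=> -[t [t0 [t1 xE]]]; exists t; split=> //; split=> //.
  by rewrite -[x](barvK R r d) xE; apply/rowP => i; rewrite !mxE; ring.
by rewrite xE; apply/rowP => i; rewrite !mxE; field.
Qed.

(** * The trichotomy at a vertex of Delta *)

Theorem theorem3p8 (R : realType) (r : nat) (d : 'I_r -> nat)
    (W : seq 'rV[int]_r) (A : 'rV[int]_r -> R)
    (C : seq 'rV[R]_r) (F : 'rV[R]_r -> R)
    (cb : 'rV[R]_r) (l : 'rV[R]_r) (beta : R) (xib : 'rV[R]_r) :
  (2 <= r)%N ->
  (forall i, (0 < d i)%N) ->
  (* the exponent set W of the scalar curvature, with its coefficients *)
  uniq W ->
  (forall w, w \in W ->
     (typeI w /\ 0 < A w) \/ (typeII w /\ A w < 0) \/ (typeIII w /\ A w < 0)) ->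
  affdim [seq realv R w | w <- W] = r.-1 ->
  (* u = sum_{c in C} F_c e^{c.q} is a superpotential, normalised C ⊂ H *)
  uniq C ->
  (forall c, c \in C -> F c != 0) ->
  (forall c, c \in C -> inH d c) ->
  (forall xi : 'rV[R]_r,
     \sum_(a <- C) \sum_(c <- C | a + c == xi) Jform d a c * F a * F c
     = \sum_(w <- W | dvec d + realv R w == xi) A w) ->
  (* cb is a null vertex of conv(C) *)
  cb \in C -> is_null d cb -> is_vertex (conv C) cb ->
  (* H' = { x in H | l.x = beta } is an affine hyperplane of H strictly
     separating cb from K = conv((d+W)/2) *)
  (~ exists k : R, l = k *: const_mx 1) ->
  beta < dotv l cb ->
  (forall z, conv [seq barv d (realv R w) | w <- W] z -> dotv l z < beta) ->
  (* xib is a vertex of Delta = P(K) *)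
  is_vertex (fun y => exists z, conv [seq barv d (realv R w) | w <- W] z /\
               exists t : R, 0 <= t /\ y = cb + t *: (z - cb) /\
               inH d y /\ dotv l y = beta) xib ->
  exactly_one3
    (* (1A) *)
    (Jform d cb xib = 0 /\
     forall z, conv [seq barv d (realv R w) | w <- W] z ->
       (exists t : R, 0 <= t /\ xib = cb + t *: (z - cb)) ->
       Jform d cb z = 0)
    (* (1B) *)
    (exists xb, (conv [seq barv d (realv R w) | w <- W] xb /\ on_line cb xib xb) /\
       (forall y, conv [seq barv d (realv R w) | w <- W] y -> on_line cb xib y ->
          y = xb) /\
       exists ab, ab \in C /\ is_null d ab /\ 2^-1 *: (ab + cb) = xb)
    (* (2) *)
    (Jform d cb xib != 0 /\
     exists vb wb,
       is_edge (conv [seq barv d (realv R w) | w <- W]) vb wb /\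
       on_line vb wb cb /\ on_line vb wb xib /\
       is_edge (conv [seq realv R w | w <- W])
               (2 *: vb - dvec d) (2 *: wb - dvec d) /\
       on_line (2 *: vb - dvec d) (2 *: wb - dvec d) (2 *: cb - dvec d) /\
       on_line (2 *: vb - dvec d) (2 *: wb - dvec d) (2 *: xib - dvec d)).
Proof.
move=> _ d_gt0 W_uniq W_type _ C_uniq F_neq0 C_inH superpot cbC cb_null cb_vertex.
move=> _ l_cb l_K [Dxib extr].
set gens := [seq barv d (realv R w) | w <- W] in l_K Dxib extr *.
have l_gens p : p \in gens -> dotv l (p - cb) < 0.
  by move=> /conv_mem/l_K lp; rewrite dotvBr subr_lt0 (lt_trans lp).
have gens_inH p : p \in gens -> inH d p.
  move=> /mapP[w /W_type wT ->]; apply/barv_inH/sum_weight.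
  by case: wT => [|[|]] []; tauto.
have A_neq0 w : w \in W -> A w != 0.
  by move=> /W_type[[_ /gt_eqF->]|[] [_ /lt_eqF->]].
have [l_xib [z0 z0K z0_line]] : dotv l xib = beta /\
    exists2 z, conv gens z & on_line cb xib z.
  case: Dxib => z [zK [t [t0 [xE [_ lx]]]]]; split=> //; exists z => //.
  have tN0 : t != 0.
    apply: contraTneq l_cb => t00.
    by rewrite -lx xE t00 scale0r addr0 ltxx.
  by exists t^-1; rewrite xE addrAC subrr add0r scalerA mulVf // scale1r addrC subrK.
have l_rho : dotv l (xib - cb) < 0 by rewrite dotvBr l_xib subr_lt0.
have xib_cb : xib != cb by apply: contraTneq l_rho => ->; rewrite subrr dotv0r ltxx.
have cb_inH : inH d cb := C_inH cb cbC.
have [|f f_xib f_gens] := exposed_ray gens l cb xib l_gens l_rho.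
  (* The hull of the projected generators lies in Delta, so the extremality of [xib] applies to
     it. *)
  have sub y : conv [seq central_proj l cb xib p | p <- gens] y ->
      exists z, conv gens z /\ exists t : R, 0 <= t /\ y = cb + t *: (z - cb) /\
               inH d y /\ dotv l y = beta.
    move=> yP; have [z zK [t t0 yE]] := central_proj_conv gens l cb xib y l_gens l_rho yP.
    exists z; split=> //; exists t; split=> //; split=> //; split.
      rewrite /inH -dotv_unitl; apply: conv_eq yP _ => _ /mapP[p pg ->].
      rewrite dotvDr dotvZr (dotvBr (const_mx 1)) !dotv_unitl (gens_inH p pg) cb_inH.
      by rewrite subrr mulr0 addr0.
    apply: conv_eq yP _ => _ /mapP[p pg ->].
    by rewrite dotvDr dotvZr divfK ?lt_eqF ?l_gens // -dotvDr addrC subrK.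
  by move=> y z t /sub yD /sub zD; exact: extr.
have f_le p : p \in gens -> dotv f p <= dotv f cb.
  case/f_gens => [/(on_line_dotv f _ _ _ f_xib) -> //|].
  by rewrite dotvBr subr_lt0 => /ltW.
have face_line p : p \in gens -> dotv f p = dotv f cb -> on_line cb xib p.
  by case/f_gens => // + fp; rewrite dotvBr fp subrr ltxx.
have line_J z : on_line cb xib z -> z != cb ->
    (Jform d cb z == 0) = (Jform d cb xib == 0).
  move=> [s ->] zcb; rewrite JformDr JformZr JformBr cb_null add0r subr0.
  have s0 : s != 0 by apply: contraNneq zcb => ->; rewrite scale0r addr0.
  by rewrite mulf_eq0 (negbTE s0).
have K_cb z : conv gens z -> z != cb.
  by move=> /l_K; apply: contraTneq => ->; rewrite -leNgt ltW.
pose face := [seq p <- gens | dotv f p == dotv f cb].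
have faceP p : p \in face -> p \in gens /\ on_line cb xib p.
  by rewrite mem_filter => /andP[/eqP fp pg]; split=> //; exact: face_line.
have mem_face p : p \in gens -> on_line cb xib p -> p \in face.
  by move=> pg /(on_line_dotv f _ _ _ f_xib) fp; rewrite mem_filter pg fp eqxx.
(* [z0] attains the bound [dotv f cb], so some generator attains it too. *)
have [p0 p0_face] : exists p, p \in face.
  have [p1 p1g] := conv_nonempty gens z0 z0K.
  have [p pg pmax] := seq_argmax gens (dotv f) p1 p1g.
  exists p; rewrite mem_filter pg andbT eq_le f_le //.
  rewrite -(on_line_dotv f _ _ _ f_xib z0_line).
  exact: conv_le z0K pmax.
(* [l] decreases along the ray from [cb]: [v] is the nearest generator on it and [w] the
   farthest. *)
have [v v_face v_max] := seq_argmax face (dotv l) p0 p0_face.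
have [w w_face] := seq_argmax face (fun p => - dotv l p) p0 p0_face.
have [vg v_line] := faceP v v_face; have [wg w_line] := faceP w w_face.
move=> w_min; have {}w_min p : p \in face -> dotv l w <= dotv l p.
  by move/w_min; rewrite lerN2.
(* Case (1A). Under (1B) the null [a] would be orthogonal to [cb], hence equal to it, and [cb] would
   lie in the hull. *)
have [J0|J0] := eqVneq (Jform d cb xib) 0.
  left; split; [split=> // z zK [t [t0 xE]]|split; last by case=> /eqP].
    have tN0 : t != 0.
      by apply: contraNneq xib_cb => t00; rewrite xE t00 scale0r addr0.
    move: J0; rewrite xE JformDr JformZr JformBr cb_null add0r subr0 => /eqP.
    by rewrite mulf_eq0 (negbTE tN0) => /eqP.
  case=> x [[xK x_line] [_ [a [aC [a_null xE]]]]].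
  have Jx : Jform d cb x = 0 by apply/eqP; rewrite line_J ?K_cb // J0.
  have Ja : Jform d cb a = 0.
    move: Jx; rewrite -xE JformZr JformDr cb_null addr0 => /eqP.
    by rewrite mulf_eq0 invr_eq0 pnatr_eq0 => /eqP.
  have acb : a = cb by apply: (orthogonal_null_eq d cb a) => //; exact: C_inH.
  have /eqP[] := K_cb x xK; rewrite -xE acb -[cb + cb]mulr2n -scaler_nat.
  by rewrite scalerA mulVf ?pnatr_eq0 // scale1r.
have l_inj := on_line_inj l cb xib _ _ (ltr0_neq0 l_rho).
(* If v = w, the line meets the hull in [v] alone: this is (1B), and an edge on the line would have
   both ends at [v]. *)
have [vw|/eqP vw] := eqVneq v w.
  have face_v p : p \in face -> p = v.
    move=> pf; have [pg p_line] := faceP p pf; apply: l_inj => //.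
    by apply/eqP; rewrite eq_le v_max //= vw w_min.
  have uniq_v y : conv gens y -> on_line cb xib y -> y = v.
    move=> yK y_line; apply: l_inj => //.
    have f_y := on_line_dotv f _ _ _ f_xib y_line.
    have both g : dotv g y <= dotv g v.
      apply: (conv_face_le gens y f _ g _ yK f_le f_y) => p pg fp.
      by rewrite (face_v p) // mem_filter fp eqxx.
    apply/eqP; rewrite eq_le both -lerN2 -!dotvNl; exact: both.
  right; left; split; first by case=> J0'; rewrite J0' eqxx in J0.
  split; last first.
    case=> _ [a [b [[ab [g [k [_ edge]]]] [cb_ab [xib_ab _]]]]].
    have in_seg x : segment a b x -> conv gens x by case/edge.
    have line_x x : on_line a b x -> on_line cb xib x.
      apply: on_line_change cb_ab xib_ab => cbx.
      by rewrite cbx eqxx in xib_cb.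
    apply: ab; transitivity v; [|symmetry]; apply: uniq_v.
    - by apply: in_seg; exists 0; rewrite lexx ler01 subr0 scale1r scale0r addr0.
    - by apply: line_x; exists 0; rewrite scale0r addr0.
    - by apply: in_seg; exists 1; rewrite lexx ler01 subrr scale1r scale0r add0r.
    - by apply: line_x; exists 1; rewrite scale1r addrC subrK.
  exists v; split; first by split=> //; exact: conv_mem.
  split=> //; have /mapP[w0 w0W vE] := vg.
  have [||||a aC aP] := isolated_ray d W A C F d_gt0 C_uniq F_neq0 C_inH superpot
      cb cbC cb_null cb_vertex W_uniq A_neq0 f l w0 w0W.
  - by move=> u uW; apply: l_gens; exact: map_f.
  - move=> u uW; have ug : barv d (realv R u) \in gens by exact: map_f.
    case: (f_gens _ ug) => [u_line|]; [left|by right].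
    by rewrite -vE; apply: face_v; exact: mem_face.
  - by rewrite -vE dotvBr (on_line_dotv f _ _ _ f_xib v_line) subrr.
  - by rewrite -vE line_J // K_cb //; exact: conv_mem.
  by exists a; rewrite vE.
(* Case (2): [v] and [w] are distinct points of the hull on the line, which excludes (1B). *)
right; right; split; first by case=> J0'; rewrite J0' eqxx in J0.
have vK := conv_mem gens v vg; have wK := conv_mem gens w wg.
split.
  case=> x [_ [uniq_x _]]; apply: vw.
  by rewrite (uniq_x v) // (uniq_x w).
have lwv : dotv l w < dotv l v.
  rewrite lt_def w_min // andbT; apply/eqP => lvw.
  by apply: vw; exact: l_inj.
have edge : is_edge (conv gens) v w.
  split=> //; exists f, (dotv f cb); split=> [x xK|x]; first exact: conv_le xK f_le.
  split=> [[xK fx]|[t [t0 [t1 ->]]]]; last first.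
    split; first exact: conv_segment.
    rewrite dotvDr !dotvZr (on_line_dotv f _ _ _ f_xib v_line).
    by rewrite (on_line_dotv f _ _ _ f_xib w_line); ring.
  have x_line := on_line_conv gens cb xib f x xK f_gens f_xib xib_cb fx.
  have lxv : dotv l x <= dotv l v.
    apply: (conv_face_le gens x f _ l _ xK f_le fx) => p pg fp.
    by apply: v_max; rewrite mem_filter fp eqxx.
  have lwx : dotv l w <= dotv l x.
    rewrite -lerN2 -!dotvNl.
    apply: (conv_face_le gens x f _ _ _ xK f_le fx) => p pg fp.
    by rewrite !dotvNl lerN2 w_min // mem_filter fp eqxx.
  have dl : 0 < dotv l v - dotv l w by rewrite subr_gt0.
  (* The parameter is read off from [l], which is injective on the line. *)
  exists ((dotv l v - dotv l x) / (dotv l v - dotv l w)).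
  split; first by rewrite divr_ge0 ?subr_ge0 // ltW.
  split; first by rewrite ler_pdivrMr // mul1r lerD2l lerN2.
  apply: l_inj => //; last by rewrite dotvDr !dotvZr; field; rewrite gt_eqF.
  have [a aE] := v_line; have [b bE] := w_line.
  set t := _ / _; exists ((1 - t) * a + t * b); rewrite {1}aE {1}bE.
  by apply/rowP => i; rewrite !mxE; ring.
have cb_vw : on_line v w cb.
  apply: on_line_change v_line w_line _ => //.
  by exists 0; rewrite scale0r addr0.
have xib_vw : on_line v w xib.
  apply: on_line_change v_line w_line _ => //.
  by exists 1; rewrite scale1r addrC subrK.
split=> //; exists v, w; split=> //; split=> //; split=> //.
split; first exact: is_edge_barv.
by split; apply: on_line_homothety.
Qed.
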